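(* (1) The problem $\textsf{NIN}$ $N$-reduces to $\textsf{HBU}$. (2) Cantor's theorem $N$-reduces to $\textsf{HBU}$ restricted to functions $\Psi$ of Baire class $2$.
   Context: Work in the language of higher-order arithmetic: type $0$ objects are natural numbers, type $1$ elements of $\mathbb{N}^{\mathbb{N}}$, type $2$ functionals $\mathbb{N}^{\mathbb{N}}\to\mathbb{N}$. Reals are represented by elements of $\mathbb{N}^{\mathbb{N}}$ in the standard way so that quantifiers over $[0,1]$ are quantifiers over $\mathbb{N}^{\mathbb{N}}$; functions $[0,1]\to\mathbb{R}$ or $[0,1]\to\mathbb{N}$ are type-2 objects and subsets of $[0,1]$ are given by characteristic functions. A ''problem'' is a statement of the form $(\forall Y^{2})(\exists x^{1})A(Y,x)$ (with higher-type inputs coded as type-2 objects and outputs such as reals or finite sequences of reals coded as type-1 objects). For problems $P_A\equiv(\forall Y^{2})(\exists x^{1})A(Y,x)$ and $P_B\equiv(\forall Z^{2})(\exists y^{1})B(Z,y)$, $P_B$ $N$-reduces to $P_A$ if there are $e\in\mathbb{N}$ and terms $s$, $t$ of Gödel's system $T$ with $(\forall Z^{2},x^{1})\big[A(t(Z),x)\to[\{e\}^{s(Z,x)}\downarrow\wedge B(Z,\{e\}^{s(Z,x)})]\big]$, where $\{e\}^{X}$ is the $e$-th Turing machine with oracle $X$. $\textsf{NIN}$: there is no injection from $[0,1]$ to $\mathbb{N}$; as a problem: for every $Z:[0,1]\to\mathbb{N}$ there are $x,y\in[0,1]$ with $x\neq y$ and $Z(x)=Z(y)$. Cantor's theorem: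 for every set $A\subseteq[0,1]$ and every $Y:[0,1]\to\mathbb{N}$ that is injective on $A$, there is $x\in[0,1]\setminus A$. $\textsf{HBU}$: for every $\Psi:[0,1]\to\mathbb{R}^{+}$ there are $x_0,\dots,x_k\in[0,1]$ with $[0,1]\subseteq\bigcup_{i\leq k}B(x_i,\Psi(x_i))$, $B(x,r)$ the open ball. Its restriction to Baire class $2$ functions asserts this only for $\Psi$ of Baire class $2$ (pointwise limits of sequences of Baire class $1$ functions, these being pointwise limits of sequences of continuous functions). *)

(* Defs.v *)
From Stdlib Require Cantor.
From HB Require Import structures.
From mathcomp Require Import all_boot all_order all_algebra.
From mathcomp Require Import all_classical all_reals all_analysis.

Set Implicit Arguments.
Unset Strict Implicit.
Unset Printing Implicit Defensive.

Import Order.TTheory GRing.Theory Num.Theory.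
Import numFieldNormedType.Exports.

Local Open Scope classical_set_scope.
Local Open Scope ring_scope.

Definition type1 : Type := nat -> nat.
Definition type2 : Type := type1 -> nat.

(** * Goedel's system T *)

Inductive ty : Type := Nat | Arr of ty & ty.

(* Full (set-theoretic) type structure over nat. *)
Fixpoint den (a : ty) : Type :=
  if a is Arr b c then den b -> den c else nat.

Inductive var : seq ty -> ty -> Type :=
| VZ G a : var (a :: G) a
| VS G a b : var G a -> var (b :: G) a.

(* Intrinsically typed lambda-terms with de Bruijn indices. *)
Inductive term : seq ty -> ty -> Type :=
| Var G a : var G a -> term G a
| Lam G a b : term (a :: G) b -> term G (Arr a b)
| App G a b : term G (Arr a b) -> term G a -> term G b
| Zero G : term G Nat
| Succ G : term G (Arr Nat Nat)
| Rec G a : term G (Arr a (Arr (Arr Nat (Arr a a)) (Arr Nat a))).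

Fixpoint env (G : seq ty) : Type :=
  if G is a :: G' then (den a * env G')%type else unit.

Fixpoint lookup_var G a (v : var G a) : env G -> den a :=
  match v in var G a return env G -> den a with
  | VZ _ _ => fun rho => rho.1
  | VS _ _ _ w => fun rho => lookup_var w rho.2
  end.

Fixpoint eval G a (t : term G a) : env G -> den a :=
  match t in term G a return env G -> den a with
  | Var _ _ v => fun rho => lookup_var v rho
  | Lam _ _ _ u => fun rho x => eval u (x, rho)
  | App _ _ _ u v => fun rho => (eval u rho) (eval v rho)
  | Zero _ => fun=> 0%N
  | Succ _ => fun=> S
  | Rec _ a => fun=> fun (z : den a) (f : nat -> den a -> den a) =>
      fix rec (n : nat) : den a := if n is n'.+1 then f n' (rec n') else z
  end.

Definition interp a (t : term [::] a) : den a := eval t tt.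

Definition Ty1 : ty := Arr Nat Nat.
Definition Ty2 : ty := Arr Ty1 Nat.

(** * Oracle Turing machines *)

Inductive move : Type := MoveLeft | Stay | MoveRight.

Definition move_code (d : move) : option bool :=
  match d with MoveLeft => Some false | Stay => None | MoveRight => Some true end.
Definition move_decode (o : option bool) : move :=
  match o with
  | Some false => MoveLeft | None => Stay | Some true => MoveRight
  end.
Lemma move_codeK : cancel move_code move_decode. Proof. by case. Qed.
HB.instance Definition _ := Countable.copy move (can_type move_codeK).

(* A two-way infinite tape over {blank = false, 1 = true}; cells beyond the two
   lists are blank, and both lists start next to the head. *)
Record tape : Type := Tape { lft : seq bool; cur : bool; rgt : seq bool }.

Definition write (b : bool) (t : tape) : tape := Tape (lft t) b (rgt t).

Definition shift (d : move) (t : tape) : tape :=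
  match d with
  | MoveLeft => Tape (behead (lft t)) (head false (lft t)) (cur t :: rgt t)
  | Stay => t
  | MoveRight => Tape (cur t :: lft t) (head false (rgt t)) (behead (rgt t))
  end.

(* The head scans the leftmost of n consecutive 1s. *)
Definition unary (n : nat) : tape := Tape [::] (0 < n)%N (nseq n.-1 true).

Definition ones (t : tape) : nat :=
  (count id (lft t) + cur t + count id (rgt t))%N.

(* ((q, (a, b)), (q', (a', b'), (d, d'))): in state q, scanning a on the work
   tape and b on the query tape, write a' and b', move the two heads by d and
   d', and enter state q'. *)
Definition instr : Type :=
  ((nat * (bool * bool)) * (nat * (bool * bool) * (move * move)))%type.

Definition program : Type := seq instr.

Record config : Type := Config { state : nat; work : tape; query : tape }.

Definition start_state : nat := 0%N.
Definition query_state : nat := 1%N.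
Definition answer_state : nat := 2%N.

(* In query_state the machine replaces the number m on the query tape by X m.
   In other states it obeys the first applicable instruction, and it halts
   (None) when there is none. *)
Definition step (p : program) (X : type1) (c : config) : option config :=
  if state c == query_state then
    Some (Config answer_state (work c) (unary (X (ones (query c)))))
  else
    omap
      (fun i : instr =>
         let: (q, (a, b), (d, d')) := i.2 in
         Config q (shift d (write a (work c))) (shift d' (write b (query c))))
      (ohead [seq i <- p
               | i.1 == (state c, (cur (work c), cur (query c)))]).

Definition init (n : nat) : config := Config start_state (unary n) (unary 0).

Definition run (p : program) (X : type1) (k : nat) (c : config) : config :=
  iter k (fun c => odflt c (step p X c)) c.

(* pickle is an effective, injective numbering of programs; numbers that code no
   program are assigned the empty one. *)
Definition machine (e : nat) : program := odflt [::] (unpickle e).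

(* {e}^X(n) = m *)
Definition computes (e : nat) (X : type1) (n m : nat) : Prop :=
  exists k : nat, let c := run (machine e) X k (init n) in
    step (machine e) X c = None /\ ones (work c) = m.

(** * Problems and N-reduction *)

(* The problem (forall Y^2)(exists x^1) A(Y, x) is given by its matrix A. *)
Definition problem : Type := type2 -> type1 -> Prop.

(* {e}^X as a type 1 object converges when it is total; y below is {e}^X. *)
Definition N_reduces (B A : problem) : Prop :=
  exists (e : nat) (s : term [::] (Arr Ty2 (Arr Ty1 Ty1)))
         (t : term [::] (Arr Ty2 Ty2)),
    forall (Z : type2) (x : type1),
      A (interp t Z) x ->
      exists y : type1,
        (forall n, computes e (interp s Z x) n (y n)) /\ B Z y.

(** * Representation of reals and of functions on the unit interval *)

(* The code <n, m> stands for (n/2)/(m+1) if n is even and for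
   -((n+1)/2)/(m+1) if n is odd. *)
Definition rat_of_code (c : nat) : rat :=
  let: (n, m) := Cantor.of_nat c in
  (if odd n then - (uphalf n)%:R else (n./2)%:R) / (m.+1)%:R.

Definition fast_cauchy (x : type1) : Prop :=
  forall n i : nat,
    `|rat_of_code (x n) - rat_of_code (x (n + i)%N)| < (2 ^+ n)^-1.

Definition cons_fun (n : nat) (x : type1) : type1 :=
  fun k => if k is k'.+1 then x k' else n.

(* The n-th component of a sequence of type 2 objects coded by one of them. *)
Definition section (Y : type2) (n : nat) : type2 := fun x => Y (cons_fun n x).

Section Representations.
Variable R : realType.

Definition represents (x : type1) (r : R) : Prop :=
  fast_cauchy x /\ (ratr (rat_of_code (x n)) : R) @[n --> \oo] --> r.

(* Functions on [0,1] are total functions on R of which only the values on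
   [0,1] matter. *)
Definition codes_nat_fun (Y : type2) (g : R -> nat) : Prop :=
  forall (x : type1) (r : R), r \in `[0, 1] -> represents x r -> Y x = g r.

Definition codes_set (Y : type2) (A : set R) : Prop :=
  codes_nat_fun Y (fun r => nat_of_bool (r \in A)).

(* A map N^N -> N^N is coded by Y with (F x) n = Y (n, x 0, x 1, ...). *)
Definition codes_real_fun (Y : type2) (f : R -> R) : Prop :=
  forall (x : type1) (r : R), r \in `[0, 1] -> represents x r ->
    represents (fun n => section Y n x) (f r).

(* Baire classes of functions on [0,1]. *)
Fixpoint baire_class (n : nat) (f : R -> R) : Prop :=
  if n is n'.+1 then
    exists g : nat -> R -> R,
      (forall k, baire_class n' (g k)) /\
      (forall r : R, r \in `[0, 1] -> g k r @[k --> \oo] --> f r)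
  else {within `[0, 1], continuous f}.

(* w codes the nonempty finite sequence of reals p 0, ..., p k. *)
Definition codes_points (w : type1) (k : nat) (p : nat -> R) : Prop :=
  w 0%N = k /\
  forall i, (i <= k)%N -> represents (fun n => w (Cantor.to_nat (i, n)).+1) (p i).

Definition covering (Psi : R -> R) (w : type1) : Prop :=
  exists (k : nat) (p : nat -> R),
    [/\ codes_points w k p,
        forall i, (i <= k)%N -> p i \in `[0, 1] &
        `[0, 1] `<=` \bigcup_(i in [set i | (i <= k)%N]) ball (p i) (Psi (p i))].

Definition positive_on_unit (Psi : R -> R) : Prop :=
  forall r : R, r \in `[0, 1] -> 0 < Psi r.

Definition HBU : problem := fun Y w =>
  forall Psi, codes_real_fun Y Psi -> positive_on_unit Psi -> covering Psi w.

Definition HBU_Baire2 : problem := fun Y w =>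
  forall Psi, codes_real_fun Y Psi -> positive_on_unit Psi ->
    baire_class 2 Psi -> covering Psi w.

(* The two reals are interleaved in y. *)
Definition NIN : problem := fun Z y =>
  forall g, codes_nat_fun Z g ->
    exists r r' : R,
      [/\ represents (fun n => y n.*2) r /\ represents (fun n => y n.*2.+1) r',
          r \in `[0, 1], r' \in `[0, 1], r <> r' & g r = g r'].

(* The input codes the pair (A, g) by its sections 0 and 1. *)
Definition Cantor_thm : problem := fun Z y =>
  forall (A : set R) (g : R -> nat),
    A `<=` `[0, 1] -> codes_set (section Z 0) A ->
    codes_nat_fun (section Z 1) g ->
    (forall r r', A r -> A r' -> g r = g r' -> r = r') ->
    exists r : R, [/\ represents y r, r \in `[0, 1] & ~ A r].

End Representations.

(* Main.v *)
(** Write 2^-(m+4) for the radius attached to m. If [0,1] is covered by balls,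
    each with the radius attached to its label m, then two centers with the same
    label m must be more than 2^-(m+4) apart: otherwise all the balls labelled m
    would lie in one ball of radius 2^-(m+3), and these have total length 1/2.

    For NIN, label x by Z(x). The two centers obtained from a finite cover are
    apart by a distance bounded below in terms of their label, so a bounded
    search comparing rational approximations of known precision finds them. It
    is carried out in system T, and the Turing machine only copies its oracle.

    For Cantor's theorem, label x in A by Y(x), and use the radius 1 off A. As Y
    is injective on A, the centers of a finite cover cannot all be in A, and one
    outside A is found by evaluating the characteristic function of A. The
    radius is of Baire class 2, as it differs from a constant on a countable
    set. *)

From Stdlib Require Cantor.
From mathcomp Require Import all_boot all_order all_algebra.
From mathcomp Require Import all_classical all_reals all_analysis.
From mathcomp Require Import zify ring lra.
Require Import Defs.

Set Implicit Arguments.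
Unset Strict Implicit.
Unset Printing Implicit Defensive.

Import Order.TTheory GRing.Theory Num.Theory.
Import numFieldNormedType.Exports.

Local Open Scope classical_set_scope.
Local Open Scope ring_scope.

(** * The oracle-copying machine *)

Definition scan (L s : seq bool) : tape := Tape L (head false s) (behead s).

Lemma unary_scan n : unary n = scan [::] (nseq n true).
Proof. by case: n. Qed.

Lemma run_sweep p X q a b a' b' n L s Q t :
  q != query_state ->
  ohead [seq i <- p | i.1 == (q, (a, b))] =
    Some (q, (a, b), (q, (a', b'), (MoveRight, MoveRight))) ->
  (forall i, (i < n)%N -> nth false s i = a) ->
  (forall i, (i < n)%N -> nth false t i = b) ->
  run p X n (Config q (scan L s) (scan Q t)) =
  Config q (scan (nseq n a' ++ L) (drop n s))
    (scan (nseq n b' ++ Q) (drop n t)).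
Proof.
move=> /negPf q_query rule; elim: n L s Q t => [|n IHn] L s Q t sa tb.
  by rewrite !drop0.
rewrite /run iterSr /step /= q_query -!nth0 sa// tb// rule /=.
rewrite -/(scan (a' :: L) (behead s)) -/(scan (b' :: Q) (behead t)).
rewrite -/(run p X n _) IHn => [|i lti|i lti].
- by rewrite -!drop1 !drop_drop addn1 -!(cat1s _ L) -!(cat1s _ Q) !catA
    -!(nseqD n 1) addn1.
- by rewrite nth_behead sa.
- by rewrite nth_behead tb.
Qed.

(* The input is erased while it is copied to the query tape, since every 1 left
   on the work tape counts as output. *)
Definition copy_program : program :=
  [:: ((start_state, (true, false)),
       (start_state, (false, true), (MoveRight, MoveRight)));
      ((start_state, (false, false)),
       (query_state, (false, false), (Stay, Stay)));
      ((answer_state, (false, true)),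
       (answer_state, (true, true), (MoveRight, MoveRight)))].

Lemma run_copy (X : type1) (n : nat) :
  run copy_program X (X n + (2 + n)) (init n) =
  Config answer_state (scan (nseq (X n) true ++ nseq n false) [::])
    (scan (nseq (X n) true) [::]).
Proof.
have nth_ones m i : (i < m)%N -> nth false (nseq m true) i = true.
  by move=> ltim; rewrite nth_nseq ltim.
have nth_blank m i : (i < m)%N -> nth false [::] i = false by rewrite nth_nil.
rewrite /run !iterD /init !unary_scan -/(run _ _ n _).
rewrite (run_sweep (a' := false) (b' := true) X [::] [::] _ _
  (@nth_ones n) (@nth_blank n))// !drop_oversize ?size_nseq// !cats0.
rewrite /= /ones /= count_nseq mul1n !addn0 unary_scan.
rewrite -/(scan (nseq n false) [::]) -/(run _ _ (X n) _).
rewrite (run_sweep (a' := true) (b' := true) X _ [::] _ _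
  (@nth_blank (X n)) (@nth_ones (X n)))//.
by rewrite !drop_oversize ?size_nseq// cats0.
Qed.

Lemma computes_copy (X : type1) (n : nat) :
  computes (pickle copy_program) X n (X n).
Proof.
rewrite /computes /machine pickleK; exists (X n + (2 + n))%N.
rewrite run_copy; split=> //.
by rewrite /ones /= count_cat !count_nseq mul0n mul1n !addn0.
Qed.

Lemma N_reduces_by_terms (B A : problem)
    (s : term [::] (Arr Ty2 (Arr Ty1 Ty1))) (t : term [::] (Arr Ty2 Ty2)) :
  (forall Z x, A (interp t Z) x -> B Z (interp s Z x)) -> N_reduces B A.
Proof.
move=> red; exists (pickle copy_program), s, t => Z x /red BZ.
by exists (interp s Z x); split=> // n; exact: computes_copy.
Qed.

(** * Arithmetic in system T *)

Declare Scope systemT_scope.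
Delimit Scope systemT_scope with sysT.
Local Notation "u $ v" := (App u v) (at level 20, left associativity).
Local Notation v0 := (Var (VZ _ _)).
Local Notation v1 := (Var (VS _ (VZ _ _))).
Local Notation v2 := (Var (VS _ (VS _ (VZ _ _)))).
Local Notation v3 := (Var (VS _ (VS _ (VS _ (VZ _ _))))).
Local Notation "u .+1" := (Succ _ $ u) : systemT_scope.

Fixpoint numeral {G} n : term G Nat :=
  if n is n'.+1 then Succ G $ numeral n' else Zero G.

Lemma eval_numeral G (rho : env G) n : eval (numeral n) rho = n.
Proof. by elim: n => //= n ->. Qed.
Opaque numeral.

Definition tadd {G} : term G (Arr Nat (Arr Nat Nat)) :=
  Lam (Lam (Rec _ Nat $ v1 $ Lam (Lam v0.+1) $ v0))%sysT.
Local Notation "u + v" := (tadd $ u $ v) : systemT_scope.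

Lemma eval_tadd G (rho : env G) m n : eval tadd rho m n = (m + n)%N.
Proof. by elim: n => [|n /= ->]; rewrite ?addn0 ?addnS. Qed.
Opaque tadd.

Definition tpred {G} : term G (Arr Nat Nat) :=
  Lam (Rec _ Nat $ Zero _ $ Lam (Lam v1) $ v0).
Local Notation "u .-1" := (tpred $ u) : systemT_scope.

Lemma eval_tpred G (rho : env G) n : eval tpred rho n = n.-1.
Proof. by case: n. Qed.
Opaque tpred.

Definition tsub {G} : term G (Arr Nat (Arr Nat Nat)) :=
  Lam (Lam (Rec _ Nat $ v1 $ Lam (Lam v0.-1) $ v0))%sysT.
Local Notation "u - v" := (tsub $ u $ v) : systemT_scope.

Lemma eval_tsub G (rho : env G) m n : eval tsub rho m n = (m - n)%N.
Proof. by elim: n => [|n /= ->]; rewrite ?subn0 // eval_tpred subnS. Qed.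
Opaque tsub.

Definition tmul {G} : term G (Arr Nat (Arr Nat Nat)) :=
  Lam (Lam (Rec _ Nat $ Zero _ $ Lam (Lam (v3 + v0)) $ v0))%sysT.
Local Notation "u * v" := (tmul $ u $ v) : systemT_scope.

Lemma eval_tmul G (rho : env G) m n : eval tmul rho m n = (m * n)%N.
Proof. by elim: n => [|n /= ->]; rewrite ?muln0 // eval_tadd mulnS. Qed.
Opaque tmul.

Definition texp2 {G} : term G (Arr Nat Nat) :=
  Lam (Rec _ Nat $ numeral 1 $ Lam (Lam (v0 + v0)) $ v0)%sysT.

Lemma eval_texp2 G (rho : env G) n : eval texp2 rho n = (2 ^ n)%N.
Proof. by elim: n => [|n /= ->] //; rewrite eval_tadd expnS mul2n addnn. Qed.
Opaque texp2.

Definition tif {G} : term G (Arr Nat (Arr Nat (Arr Nat Nat))) :=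
  Lam (Lam (Lam (Rec _ Nat $ v0 $ Lam (Lam v3) $ v2))).

Lemma eval_tif G (rho : env G) c m n :
  eval tif rho c m n = if c == 0%N then n else m.
Proof. by case: c. Qed.
Opaque tif.

Definition tlt {G} : term G (Arr Nat (Arr Nat Nat)) :=
  Lam (Lam (numeral 1 - (numeral 1 - (v0 - v1))))%sysT.
Local Notation "u < v" := (tlt $ u $ v) : systemT_scope.

Lemma eval_tlt G (rho : env G) m n : eval tlt rho m n = (m < n)%N.
Proof. by rewrite /= !eval_tsub !eval_numeral; case: ltnP; lia. Qed.
Opaque tlt.

Definition teq {G} : term G (Arr Nat (Arr Nat Nat)) :=
  Lam (Lam (numeral 1 - ((v0 < v1) + (v1 < v0))))%sysT.
Local Notation "u == v" := (teq $ u $ v) : systemT_scope.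

Lemma eval_teq G (rho : env G) m n : eval teq rho m n = (m == n).
Proof.
by rewrite /= eval_tsub eval_tadd !eval_tlt eval_numeral; case: ltngtP.
Qed.
Opaque teq.

Definition teven {G} : term G (Arr Nat Nat) :=
  Lam (Rec _ Nat $ numeral 1 $ Lam (Lam (numeral 1 - v0)) $ v0)%sysT.

Lemma eval_teven G (rho : env G) n : eval teven rho n = ~~ odd n.
Proof. by elim: n => //= n ->; rewrite eval_tsub eval_numeral; case: odd. Qed.
Opaque teven.

Definition thalf {G} : term G (Arr Nat Nat) :=
  Lam (Rec _ Nat $ Zero _ $
    Lam (Lam ((numeral 1 - teven $ v1) + v0)) $ v0)%sysT.

Lemma eval_thalf G (rho : env G) n : eval thalf rho n = n./2.
Proof.
elim: n => [//|n /= ->].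
rewrite eval_tadd eval_tsub eval_numeral eval_teven uphalf_half.
by case: odd.
Qed.
Opaque thalf.

Definition tpair {G} : term G (Arr Nat (Arr Nat Nat)) :=
  Lam (Lam
    (v0 + Rec _ Nat $ Zero _ $ Lam (Lam (v1.+1 + v0)) $ (v0 + v1)))%sysT.

Lemma eval_tpair G (rho : env G) m n :
  eval tpair rho m n = Cantor.to_nat (m, n).
Proof.
rewrite /= !eval_tadd /Cantor.to_nat plusE; congr (_ + _)%N.
by elim: (n + m)%N => //= k ->; rewrite eval_tadd.
Qed.
Opaque tpair.
Arguments Cantor.to_nat : simpl never.

(* A pair (m, n) is represented by a function taking the values m at 0 and n at
   1, for want of product types. The recursion is that of Cantor.of_nat. *)
Definition tunpair {G} : term G (Arr Nat Ty1) :=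
  Lam (Rec _ Ty1 $ Lam (Zero _) $
    Lam (Lam (Lam (tif $ (v1 $ Zero _)
      $ (tif $ v0 $ (v1 $ numeral 1).+1 $ (v1 $ Zero _).-1)
      $ (tif $ v0 $ Zero _ $ (v1 $ numeral 1).+1))))
    $ v0)%sysT.

Lemma eval_tunpair G (rho : env G) c b : eval tunpair rho c b =
  if b == 0%N then (Cantor.of_nat c).1 else (Cantor.of_nat c).2.
Proof.
elim: c b => [|c /= IHc] b /=; first by case: ifP.
rewrite !eval_tif eval_numeral eval_tpred !IHc /= -/(Cantor.of_nat c).
by case: (Cantor.of_nat c) => -[|x] y /=; case: ifP.
Qed.
Opaque tunpair.

Definition tfst {G} : term G (Arr Nat Nat) := Lam (tunpair $ v0 $ Zero _).

Lemma eval_tfst G (rho : env G) c : eval tfst rho c = (Cantor.of_nat c).1.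
Proof. by rewrite /= eval_tunpair. Qed.
Opaque tfst.

Definition tsnd {G} : term G (Arr Nat Nat) := Lam (tunpair $ v0 $ numeral 1).

Lemma eval_tsnd G (rho : env G) c : eval tsnd rho c = (Cantor.of_nat c).2.
Proof. by rewrite /= eval_tunpair eval_numeral. Qed.
Opaque tsnd.

(* The default value n lets the search range over i <= n. *)
Definition search (a : pred nat) (n : nat) : nat := find a (iota 0 n).

Lemma search_le (a : pred nat) n : (search a n <= n)%N.
Proof. by rewrite -{2}(size_iota 0 n) find_size. Qed.

Lemma search_has (a : pred nat) n : has a (iota 0 n) -> a (search a n).
Proof.
move=> a_n; have := nth_find 0%N a_n; rewrite nth_iota ?add0n//.
by rewrite -{2}(size_iota 0 n) -has_find.
Qed.

Lemma search_default (a : pred nat) n : ~~ has a (iota 0 n) -> search a n = n.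
Proof. by move=> na_n; rewrite /search hasNfind// size_iota. Qed.

Lemma searchP (a : pred nat) n i : (i <= n)%N -> a i -> a (search a n).
Proof.
rewrite leq_eqVlt => /predU1P[-> an|lt_in ai].
  case: (boolP (has a (iota 0 n))) => [/search_has//|na_n].
  by rewrite search_default.
by apply: search_has; apply/hasP; exists i => //; rewrite mem_iota.
Qed.

Lemma searchS (a : pred nat) n :
  search a n.+1 = if a (search a n) then search a n else n.+1.
Proof.
have -> : search a n.+1 =
    if has a (iota 0 n) then search a n else (n + ~~ a n)%N.
  by rewrite {1}/search -addn1 iotaD find_cat size_iota /= add0n; case: (a n).
case: ifPn => [/search_has->//|/search_default->].
by case: (a n); rewrite ?addn0 ?addn1.
Qed.

Definition tsearch {G} : term G (Arr Ty1 (Arr Nat Nat)) :=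
  Lam (Lam (Rec _ Nat $ Zero _ $
    Lam (Lam (tif $ (v3 $ v0) $ v0 $ v1.+1)) $ v0))%sysT.

Lemma eval_tsearch G (rho : env G) (f : nat -> nat) (a : pred nat) n :
  (forall i, f i = a i) -> eval tsearch rho f n = search a n.
Proof.
move=> fa; elim: n => //= n ->.
by rewrite eval_tif searchS fa eqb0; case: (a _).
Qed.
Opaque tsearch.

(** * Sequences and functionals in system T *)

Definition tcons {G} : term G (Arr Nat (Arr Ty1 Ty1)) :=
  Lam (Lam (Lam (Rec _ Nat $ v2 $ Lam (Lam (v3 $ v1)) $ v0))).

Lemma eval_tcons G (rho : env G) n x : eval tcons rho n x = cons_fun n x.
Proof. by apply/funext => -[]. Qed.
Opaque tcons.

Definition tail (x : type1) : type1 := fun n => x n.+1.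

Definition ttail {G} : term G (Arr Ty1 Ty1) := Lam (Lam (v1 $ v0.+1))%sysT.

Lemma eval_ttail G (rho : env G) x : eval ttail rho x = tail x.
Proof. by []. Qed.
Opaque ttail.

Definition tsection {G} : term G (Arr Ty2 (Arr Nat Ty2)) :=
  Lam (Lam (Lam (v2 $ (tcons $ v1 $ v0)))).

Lemma eval_tsection G (rho : env G) Z n x :
  eval tsection rho Z n x = section Z n x.
Proof. by rewrite /= eval_tcons. Qed.
Opaque tsection.

Definition interleave (x y : type1) : type1 :=
  fun n => if odd n then y n./2 else x n./2.

Lemma interleave_double x y n : interleave x y n.*2 = x n.
Proof. by rewrite /interleave odd_double doubleK. Qed.

Lemma interleave_doubleS x y n : interleave x y n.*2.+1 = y n.
Proof. by rewrite /interleave /= odd_double /= uphalf_double. Qed.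

Definition tinterleave {G} : term G (Arr Ty1 (Arr Ty1 Ty1)) :=
  Lam (Lam (Lam
    (tif $ (teven $ v0) $ (v2 $ (thalf $ v0)) $ (v1 $ (thalf $ v0))))).

Lemma eval_tinterleave G (rho : env G) x y :
  eval tinterleave rho x y = interleave x y.
Proof.
apply/funext => n; rewrite /= eval_tif eval_teven !eval_thalf /interleave.
by case: odd.
Qed.
Opaque tinterleave.

(* The i-th of the reals coded by w in the sense of codes_points. *)
Definition point (w : type1) (i : nat) : type1 :=
  fun n => w (Cantor.to_nat (i, n)).+1.

Definition tpoint {G} : term G (Arr Ty1 (Arr Nat Ty1)) :=
  Lam (Lam (Lam (v2 $ (tpair $ v1 $ v0).+1)))%sysT.

Lemma eval_tpoint G (rho : env G) w i : eval tpoint rho w i = point w i.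
Proof. by apply/funext => n; rewrite /= eval_tpair. Qed.
Opaque tpoint.

(** * Coverings of intervals by balls *)

Lemma itv_cover_length (R : realType) (a b : R) (c r : nat -> R) :
  (forall m, 0 <= r m) -> `[a, b] `<=` \bigcup_m ball (c m) (r m) ->
  ((b - a)%:E <= \sum_(0 <= m <oo) (r m *+ 2)%:E)%E.
Proof.
move=> r0 sub.
rewrite (eq_eseriesr (fun m _ => esym (lebesgue_measure_ball (c m) (r0 m)))).
apply: (@le_trans _ _ (lebesgue_measure (`[a, b]%classic : set R))).
  rewrite lebesgue_measure_itv /= lte_fin.
  by case: ltP => // ba; rewrite lee_fin subr_le0.
apply: measure_sigma_subadditive => // m.
exact: measurable_realfun.measurable_ball.
Qed.

Lemma itv_cover_collision (R : realType) (a b : R) (e : nat -> R)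
    (I : Type) (P : set I) (p : I -> R) (v : I -> nat) :
  (forall m, 0 <= e m) ->
  (\sum_(0 <= m <oo) (e m *+ 4)%:E < (b - a)%:E)%E ->
  `[a, b] `<=` \bigcup_(i in P) ball (p i) (e (v i)) ->
  exists i j, [/\ P i, P j, v i = v j & e (v i) < p i - p j].
Proof.
move=> e0 small sub; apply: contrapT => nocol.
have le_e i j : P i -> P j -> v i = v j -> p i - p j <= e (v i).
  move=> Pi Pj vij; rewrite leNgt; apply/negP => far.
  by apply: nocol; exists i, j.
have [c cP] : exists c : nat -> R, forall i, P i -> `|p i - c (v i)| <= e (v i).
  suff /choice[c cP] : forall m, exists r, forall i,
      P i -> v i = m -> `|p i - r| <= e m by exists c => i Pi; exact: cP.
  move=> m; have [[j Pj vj]|nex] := pselect (exists2 j, P j & v j = m).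
    exists (p j) => i Pi vi; rewrite ler_norml lerNl opprB -{2}vi -{1}vj.
    by rewrite !le_e// vi vj.
  by exists 0 => i Pi vi; case: nex; exists i.
move: small; rewrite ltNge => /negP; apply.
rewrite (eq_eseriesr (fun m _ => congr1 EFin (mulrnA (e m) 2 2))).
apply: (itv_cover_length (c := c)) => [m|r /sub[i Pi]].
  by rewrite mulrn_wge0.
rewrite -!ball_normE /= => ri; exists (v i) => //=.
rewrite -(subrKA (p i)) (le_lt_trans (ler_normD _ _))// mulr2n ler_ltD//.
by rewrite distrC cP.
Qed.

Definition radius (R : realType) (m : nat) : R := 2 ^- (m + 4).

Lemma radius_gt0 (R : realType) m : 0 < radius R m.
Proof. by rewrite invr_gt0 exprn_gt0. Qed.

Lemma unit_interval_cover_collision (R : realType) (I : Type) (P : set I)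
    (p : I -> R) (v : I -> nat) :
  `[0, 1] `<=` \bigcup_(i in P) ball (p i) (radius R (v i)) ->
  exists i j, [/\ P i, P j, v i = v j & radius R (v i) < p i - p j].
Proof.
apply: itv_cover_collision => [m|]; first exact/ltW/radius_gt0.
rewrite subr0; apply: (@le_lt_trans _ _ (2^-1)%:E); last first.
  by rewrite lte_fin invf_lt1 ?ltr1n.
apply: le_trans (epsilon_trick0 xpredT _); last by rewrite invr_ge0.
apply: lee_nneseries => m _.
  by rewrite lee_fin mulrn_wge0// ltW ?radius_gt0.
suff -> : radius R m *+ 4 = 2^-1 / (2 ^ m.+1)%:R by [].
by rewrite /radius exprD natrX [2 ^+ m.+1]exprS; field; rewrite expf_neq0.
Qed.

(** * Representations of reals *)

Section Representations.
Variable R : realType.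

Lemma ratr_exprVn2 n : ratr (2 ^- n) = 2 ^- n :> R.
Proof. by rewrite fmorphV rmorphXn /= rmorph_nat. Qed.

Lemma represents_dist (x : type1) (r : R) n :
  represents x r -> `|ratr (rat_of_code (x n)) - r| <= 2 ^- n.
Proof.
move=> [cx xr].
have : `|ratr (rat_of_code (x n)) - ratr (rat_of_code (x k))| @[k --> \oo] -->
    `|ratr (rat_of_code (x n)) - r|.
  by apply: cvg_norm; apply: cvgB => //; exact: cvg_cst.
move=> /cvgr_to_le; apply; near=> k.
have nk : (n <= k)%N by near: k; exact: nbhs_infty_ge.
by rewrite -rmorphB -ratr_norm -ratr_exprVn2 ler_rat ltW // -(subnKC nk).
Unshelve. all: by end_near. Qed.

Lemma represents_cst c : represents (fun=> c) (ratr (rat_of_code c) : R).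
Proof.
split=> [n i|]; last exact: cvg_cst.
by rewrite subrr normr0 invr_gt0 exprn_gt0.
Qed.

Definition dyadic_code (n : nat) : nat := Cantor.to_nat (2, (2 ^ n).-1)%N.

Lemma rat_of_dyadic_code n : rat_of_code (dyadic_code n) = 2 ^- n.
Proof.
rewrite /rat_of_code /dyadic_code Cantor.cancel_of_to /= mul1r.
by rewrite prednK ?expn_gt0// natrX.
Qed.

Lemma codes_real_fun_dyadic (Y : type2) (h : R -> nat) :
  (forall n x r, r \in `[0, 1] -> represents x r ->
    section Y n x = dyadic_code (h r)) ->
  codes_real_fun Y (fun r => 2 ^- h r).
Proof.
move=> Yh x r r01 xr.
rewrite (_ : (fun n => _) = fun=> dyadic_code (h r)).
  by rewrite -ratr_exprVn2 -rat_of_dyadic_code; exact: represents_cst.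
by apply/funext => n; exact: Yh.
Qed.

(* A code of a negative rational is read as 0: this does not increase the
   distance to a nonnegative real, and spares the sign. *)
Definition num_code (c : nat) : nat :=
  ((Cantor.of_nat c).1./2 * ~~ odd (Cantor.of_nat c).1)%N.
Definition den_code (c : nat) : nat := (Cantor.of_nat c).2.+1.
Definition nneg_of_code (c : nat) : R := (num_code c)%:R / (den_code c)%:R.

Lemma nneg_of_code_dist c (r : R) : 0 <= r ->
  `|nneg_of_code c - r| <= `|ratr (rat_of_code c) - r|.
Proof.
move=> r0; rewrite /nneg_of_code /num_code /den_code /rat_of_code.
case: (Cantor.of_nat c) => m n /=; case: ifP => om; last first.
  by rewrite muln1 fmorph_div /= !rmorph_nat.
rewrite muln0 mul0r sub0r normrN ger0_norm// fmorph_div rmorphN /= !rmorph_nat.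
have : 0 <= (uphalf m)%:R / n.+1%:R :> R by rewrite divr_ge0.
by move=> q0; rewrite mulNr -opprD normrN ger0_norm ?addr_ge0// lerDr.
Qed.

(* The inequality of code_gapE below with its denominators cleared. *)
Definition code_gap (n c d : nat) : bool :=
  (num_code d * den_code c * 2 ^ n + 2 * (den_code c * den_code d) <
   num_code c * den_code d * 2 ^ n)%N.

Lemma code_gapE n c d :
  code_gap n c d = (2 * 2 ^- n < nneg_of_code c - nneg_of_code d).
Proof.
rewrite /code_gap /nneg_of_code -(ltr_nat R).
have : 0 < (den_code c)%:R :> R by rewrite ltr0n.
have : 0 < (den_code d)%:R :> R by rewrite ltr0n.
set u : R := (den_code c)%:R; set v : R := (den_code d)%:R => v_gt0 u_gt0.
have n_gt0 : 0 < 2 ^+ n :> R by rewrite exprn_gt0.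
rewrite -[in RHS](ltr_pM2r (mulr_gt0 (mulr_gt0 u_gt0 v_gt0) n_gt0)).
rewrite natrD !natrM natrX -/u -/v -ltrBrDl.
by congr (_ < _); field; rewrite ?gt_eqF.
Qed.

Lemma nneg_of_code_approx n x (r : R) : 0 <= r -> represents x r ->
  `|nneg_of_code (x n) - r| <= 2 ^- n.
Proof.
move=> r0 xr.
exact: le_trans (nneg_of_code_dist _ r0) (represents_dist _ xr).
Qed.

Section CodeGap.
Variables (n : nat) (x y : type1) (r s : R).
Hypotheses (r0 : 0 <= r) (s0 : 0 <= s).
Hypotheses (xr : represents x r) (ys : represents y s).

Lemma code_gap_lt : code_gap n (x n) (y n) -> s < r.
Proof.
move: (nneg_of_code_approx n r0 xr) (nneg_of_code_approx n s0 ys).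
by rewrite !ler_norml code_gapE => /andP[? ?] /andP[? ?]; lra.
Qed.

Lemma code_gap_far : 4 * 2 ^- n < r - s -> code_gap n (x n) (y n).
Proof.
move: (nneg_of_code_approx n r0 xr) (nneg_of_code_approx n s0 ys).
by rewrite !ler_norml code_gapE => /andP[? ?] /andP[? ?]; lra.
Qed.

End CodeGap.

End Representations.

Definition tdyadic {G} : term G (Arr Nat Nat) :=
  Lam (tpair $ numeral 2 $ (texp2 $ v0).-1)%sysT.

Lemma eval_tdyadic G (rho : env G) n : eval tdyadic rho n = dyadic_code n.
Proof. by rewrite /= eval_numeral eval_texp2 eval_tpred eval_tpair. Qed.
Opaque tdyadic.

Definition tnum {G} : term G (Arr Nat Nat) :=
  Lam (thalf $ (tfst $ v0) * teven $ (tfst $ v0))%sysT.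

Lemma eval_tnum G (rho : env G) c : eval tnum rho c = num_code c.
Proof. by rewrite /= eval_tmul eval_thalf eval_teven eval_tfst. Qed.
Opaque tnum.

Definition tden {G} : term G (Arr Nat Nat) := Lam (tsnd $ v0).+1%sysT.

Lemma eval_tden G (rho : env G) c : eval tden rho c = den_code c.
Proof. by rewrite /= eval_tsnd. Qed.
Opaque tden.

Definition tgap {G} : term G (Arr Nat (Arr Nat (Arr Nat Nat))) :=
  Lam (Lam (Lam
    (tnum $ v0 * tden $ v1 * texp2 $ v2 + numeral 2 * (tden $ v1 * tden $ v0) <
     tnum $ v1 * tden $ v0 * texp2 $ v2)))%sysT.

Lemma eval_tgap G (rho : env G) n c d : eval tgap rho n c d = code_gap n c d.
Proof.
rewrite /= eval_tlt eval_tadd !eval_tmul eval_numeral eval_texp2.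
by rewrite !eval_tnum !eval_tden.
Qed.
Opaque tgap.

(** * Baire classes *)

Section BaireClasses.
Variable R : realType.
Implicit Types (f h : R -> R) (c : R) (A : set R).

Lemma baire_classS n f : baire_class n f -> baire_class n.+1 f.
Proof. by move=> fn; exists (fun=> f); split=> // r _; exact: cvg_cst. Qed.

Lemma baire_class1_patch_set1 f c h :
  baire_class 1 f -> baire_class 1 (patch f [set c] h).
Proof.
move=> [g [gc gf]].
pose bump n (r : R) : R := Num.max 0 (1 - n%:R * `|r - c|).
exists (fun n r => g n r + (h c - g n c) * bump n r); split=> [n|r r01].
  apply: within_continuousD; first exact: gc.
  apply: continuous_subspaceT => r; apply: cvgM; first exact: cvg_cst.
  apply: (@continuous_max R R (fun=> 0) (fun x => 1 - n%:R * `|x - c|)).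
    exact: cvg_cst.
  apply: cvgB; first exact: cvg_cst.
  apply: cvgM; first exact: cvg_cst.
  by apply: cvg_norm; apply: cvgB => //; exact: cvg_cst.
rewrite /patch in_set1; case: eqP => [->|/eqP rc].
  apply: cvg_near_cst; near=> n.
  by rewrite /bump subrr normr0 mulr0 subr0 max_r// mulr1 subrKC.
rewrite -[f r]addr0; apply: cvgD; first exact: gf.
apply: cvg_near_cst; near=> n.
have d0 : 0 < `|r - c| by rewrite normr_gt0 subr_eq0.
rewrite /bump max_l ?mulr0// subr_le0 -ler_pdivrMr// div1r.
by near: n; exact: nbhs_infty_ger.
Unshelve. all: by end_near. Qed.

Lemma baire_class_patch_set1 n f c h :
  baire_class n.+1 f -> baire_class n.+1 (patch f [set c] h).
Proof.
elim: n f => [|n IHn] f; first exact: baire_class1_patch_set1.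
move=> [g [gn gf]]; exists (fun k => patch (g k) [set c] h); split=> [k|r r01].
  exact: IHn.
by rewrite /patch; case: ifP => _; [exact: cvg_cst|exact: gf].
Qed.

Lemma baire_class_patch_finite n f A h :
  finite_set A -> baire_class n.+1 f -> baire_class n.+1 (patch f A h).
Proof.
move=> /finite_seqP[s ->]; elim: s f => [|c s IHs] f fn.
  by rewrite set_nil patch_set0.
rewrite (_ : patch _ _ _ = patch (patch f [set` s] h) [set c] h).
  exact/baire_class_patch_set1/IHs.
apply/funext => r; rewrite /patch in_set1 !mem_setE inE.
by case: (r == c).
Qed.

Lemma baire_class_patch_countable n f A h :
  countable A -> baire_class n.+1 f -> baire_class n.+2 (patch f A h).
Proof.
move=> /countable_injP[g ginj] fn.
exists (fun k => patch f (A `&` [set r | (g r < k)%N]) h); split=> [k|r r01].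
  apply: baire_class_patch_finite => //.
  rewrite -(eq_finite_set (inj_card_eq (f := g) _)).
    by apply: sub_finite_set (finite_II k) => _ [r [_ /= gr] <-].
  by apply: sub_in2 ginj => r; rewrite !inE => -[].
apply: cvg_near_cst; near=> k.
rewrite /patch in_setI [X in _ && X]mem_set ?andbT//=.
by near: k; exact: nbhs_infty_gt.
Unshelve. all: by end_near. Qed.

End BaireClasses.

(** * Reduction of NIN *)

Definition radius_term : term [::] (Arr Ty2 Ty2) :=
  Lam (Lam (tdyadic $ (v1 $ (ttail $ v0) + numeral 4)))%sysT.

Lemma section_radius_term (Z : type2) n x :
  section (interp radius_term Z) n x = dyadic_code (Z x + 4).
Proof.
by rewrite /section /interp /= eval_tdyadic eval_tadd eval_numeral eval_ttail.
Qed.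

Section Clash.
Variables (Z : type2) (w : type1).

(* Chosen so that 4 * 2^-(m+6) is the radius of the points with Z-value m. *)
Definition precision (i : nat) : nat := (Z (point w i) + 6)%N.

Definition clash (i j : nat) : bool :=
  (Z (point w i) == Z (point w j)) &&
  code_gap (precision i) (point w i (precision i)) (point w j (precision i)).

Definition has_clash (i : nat) : bool := clash i (search (clash i) (w 0%N)).

Definition clash_left : nat := search has_clash (w 0%N).

Definition clash_right : nat := search (clash clash_left) (w 0%N).

Lemma clash_left_right i j : (i <= w 0)%N -> (j <= w 0)%N -> clash i j ->
  clash clash_left clash_right.
Proof.
by move=> iw jw ij; apply: (searchP (a := has_clash) iw); exact: searchP jw ij.
Qed.

Variables (R : realType) (g : R -> nat) (k : nat) (p : nat -> R).
Hypotheses (gZ : codes_nat_fun Z g) (wp : codes_points w k p).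
Hypothesis p01 : forall i, (i <= k)%N -> p i \in `[0, 1].

Let point_value i : (i <= k)%N -> Z (point w i) = g (p i).
Proof. by move=> ik; apply: gZ; [exact: p01|exact: wp.2 i ik]. Qed.

Let point_ge0 i : (i <= k)%N -> 0 <= p i.
Proof. by move/p01; rewrite in_itv /= => /andP[]. Qed.

Lemma clash_sound i j : (i <= k)%N -> (j <= k)%N -> clash i j ->
  g (p i) = g (p j) /\ p j < p i.
Proof.
move=> ik jk /andP[/eqP + gap]; rewrite !point_value// => gij; split=> //.
exact: code_gap_lt (point_ge0 ik) (point_ge0 jk) (wp.2 i ik) (wp.2 j jk) gap.
Qed.

Lemma clash_complete i j : (i <= k)%N -> (j <= k)%N ->
  g (p i) = g (p j) -> radius R (g (p i)) < p i - p j -> clash i j.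
Proof.
move=> ik jk gij far; rewrite /clash !point_value// gij eqxx /=.
apply: code_gap_far (point_ge0 ik) (point_ge0 jk) (wp.2 i ik) (wp.2 j jk) _.
rewrite (_ : 4 * _ = radius R (g (p i)))//.
by rewrite /precision /radius point_value// !exprD; field; rewrite expf_neq0.
Qed.

End Clash.

Definition tprecision {G} : term G (Arr Ty2 (Arr Ty1 (Arr Nat Nat))) :=
  Lam (Lam (Lam (v2 $ (tpoint $ v1 $ v0) + numeral 6)))%sysT.

Lemma eval_tprecision G (rho : env G) Z w i :
  eval tprecision rho Z w i = precision Z w i.
Proof. by rewrite /= eval_tadd eval_numeral eval_tpoint. Qed.
Opaque tprecision.

Definition tclash {G} : term G (Arr Ty2 (Arr Ty1 (Arr Nat Ty1))) :=
  Lam (Lam (Lam (Lam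
    ((v3 $ (tpoint $ v2 $ v1) == v3 $ (tpoint $ v2 $ v0)) *
     tgap $ (tprecision $ v3 $ v2 $ v1)
       $ (tpoint $ v2 $ v1 $ (tprecision $ v3 $ v2 $ v1))
       $ (tpoint $ v2 $ v0 $ (tprecision $ v3 $ v2 $ v1))))))%sysT.

Lemma eval_tclash G (rho : env G) Z w i j :
  eval tclash rho Z w i j = clash Z w i j.
Proof.
by rewrite /= eval_tmul eval_teq eval_tgap eval_tprecision !eval_tpoint mulnb.
Qed.
Opaque tclash.

Definition tclash_left {G} : term G (Arr Ty2 (Arr Ty1 Nat)) :=
  Lam (Lam (tsearch $
    Lam (tclash $ v2 $ v1 $ v0 $
      (tsearch $ (tclash $ v2 $ v1 $ v0) $ (v1 $ Zero _))) $
    (v0 $ Zero _))).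

Lemma eval_tclash_left G (rho : env G) Z w :
  eval tclash_left rho Z w = clash_left Z w.
Proof.
rewrite /= (eval_tsearch _ (a := has_clash Z w))// => i.
rewrite eval_tclash (eval_tsearch _ (a := clash Z w i))// => j.
by rewrite eval_tclash.
Qed.
Opaque tclash_left.

Definition tclash_right {G} : term G (Arr Ty2 (Arr Ty1 Nat)) :=
  Lam (Lam (tsearch $ (tclash $ v1 $ v0 $ (tclash_left $ v1 $ v0)) $
    (v0 $ Zero _))).

Lemma eval_tclash_right G (rho : env G) Z w :
  eval tclash_right rho Z w = clash_right Z w.
Proof.
rewrite /= (eval_tsearch _ (a := clash Z w (clash_left Z w)))// => j.
by rewrite eval_tclash_left eval_tclash.
Qed.
Opaque tclash_right.

Definition clash_term : term [::] (Arr Ty2 (Arr Ty1 Ty1)) :=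
  Lam (Lam (tinterleave
    $ (tpoint $ v0 $ (tclash_left $ v1 $ v0))
    $ (tpoint $ v0 $ (tclash_right $ v1 $ v0)))).

Lemma interp_clash_term Z w : interp clash_term Z w =
  interleave (point w (clash_left Z w)) (point w (clash_right Z w)).
Proof.
rewrite /interp /= eval_tinterleave !eval_tpoint.
by rewrite eval_tclash_left eval_tclash_right.
Qed.

Lemma NIN_reduces_to_HBU (R : realType) : N_reduces (NIN R) (HBU R).
Proof.
apply: (N_reduces_by_terms (s := clash_term) (t := radius_term)).
move=> Z w hbu g gZ.
have [||k [p [wp p01 cov]]] := hbu (fun r => radius R (g r)).
- apply: (codes_real_fun_dyadic (h := fun r => (g r + 4)%N)) => n x r r01 xr.
  by rewrite section_radius_term (gZ x r).
- by move=> r _; exact: radius_gt0.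
have [i [j [ik jk gij far]]] := unit_interval_cover_collision (v := g \o p) cov.
have le_k (a : pred nat) : (search a (w 0) <= k)%N by rewrite -wp.1 search_le.
have far_clash := clash_complete gZ wp p01 ik jk gij far.
rewrite -wp.1 in ik jk.
have [glr lt_rl] :=
  clash_sound gZ wp p01 (le_k _) (le_k _) (clash_left_right ik jk far_clash).
exists (p (clash_left Z w)), (p (clash_right Z w)); split=> //.
- rewrite interp_clash_term (funext (interleave_double _ _)).
  by rewrite (funext (interleave_doubleS _ _)); split; exact: wp.2 _ (le_k _).
- exact: p01 _ (le_k _).
- exact: p01 _ (le_k _).
- by apply/eqP; rewrite gt_eqF.
Qed.

(** * Reduction of Cantor's theorem *)

Definition set_radius_term : term [::] (Arr Ty2 Ty2) :=
  Lam (Lam (tdyadic $ (tif $ (tsection $ v1 $ Zero _ $ (ttail $ v0))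
    $ (tsection $ v1 $ numeral 1 $ (ttail $ v0) + numeral 4)
    $ Zero _)))%sysT.

Lemma section_set_radius_term (Z : type2) n x :
  section (interp set_radius_term Z) n x = dyadic_code
    (if section Z 0 x == 0%N then 0 else section Z 1 x + 4)%N.
Proof.
rewrite /section /interp /= eval_tdyadic eval_tif eval_tadd !eval_numeral.
by rewrite !eval_tsection eval_ttail.
Qed.

Definition outside (Z : type2) (w : type1) (i : nat) : bool :=
  section Z 0 (point w i) == 0%N.

Definition outside_term : term [::] (Arr Ty2 (Arr Ty1 Ty1)) :=
  Lam (Lam (tpoint $ v0 $
    (tsearch $ Lam (tsection $ v2 $ Zero _ $ (tpoint $ v1 $ v0) == Zero _)
      $ (v0 $ Zero _))))%sysT.

Lemma interp_outside_term Z w :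
  interp outside_term Z w = point w (search (outside Z w) (w 0%N)).
Proof.
rewrite /interp /= eval_tpoint (eval_tsearch _ (a := outside Z w))// => i.
by rewrite eval_teq eval_tsection eval_tpoint.
Qed.

Section SetRadius.
Variables (R : realType) (A : set R) (g : R -> nat).
Hypothesis ginj : forall r s, A r -> A s -> g r = g s -> r = s.

Definition set_radius (r : R) : R := 2 ^- (if r \in A then g r + 4 else 0).

Lemma baire_class2_set_radius : baire_class 2 set_radius.
Proof.
rewrite (_ : set_radius = patch (cst 1) A (radius R \o g)); last first.
  by apply/funext => r; rewrite /set_radius /patch; case: ifP; rewrite // invr1.
apply: baire_class_patch_countable.
  by apply/countable_injP; exists g => r s; rewrite !inE; exact: ginj.
by apply: baire_classS; apply: continuous_subspaceT => r; exact: cvg_cst.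
Qed.

Lemma set_radius_cover_escapes (I : Type) (P : set I) (p : I -> R) :
  `[0, 1] `<=` \bigcup_(i in P) ball (p i) (set_radius (p i)) ->
  exists2 i, P i & ~ A (p i).
Proof.
move=> cov; apply: contrapT => noescape.
have pA i : P i -> A (p i).
  by move=> Pi; apply: contrapT => nA; apply: noescape; exists i.
have [r /cov[i Pi]|i [j [Pi Pj gij]]] :=
    @unit_interval_cover_collision R I P p (g \o p).
  by rewrite /set_radius mem_set; [exists i|exact: pA].
by rewrite (ginj (pA i Pi) (pA j Pj) gij) subrr ltNge ltW ?radius_gt0.
Qed.

End SetRadius.

Lemma Cantor_thm_reduces_to_HBU_Baire2 (R : realType) :
  N_reduces (Cantor_thm R) (HBU_Baire2 R).
Proof.
apply: (N_reduces_by_terms (s := outside_term) (t := set_radius_term)).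
move=> Z w hbu A g _ AZ gZ ginj.
have [|||k [p [wp p01 cov]]] := hbu (set_radius A g).
- apply: codes_real_fun_dyadic => n x r r01 xr.
  rewrite section_set_radius_term (AZ x r)// (gZ x r)//.
  by case: (r \in A).
- by move=> r _; rewrite invr_gt0 exprn_gt0.
- exact: baire_class2_set_radius.
have outsideE i : (i <= k)%N -> outside Z w i = (p i \notin A).
  move=> ik; rewrite /outside (AZ _ (p i) (p01 i ik) (wp.2 i ik)).
  by rewrite eqb0.
have [i ik nA] := set_radius_cover_escapes ginj cov.
have i0k : (search (outside Z w) (w 0%N) <= k)%N by rewrite -wp.1 search_le.
exists (p (search (outside Z w) (w 0%N))); split.
- by rewrite interp_outside_term; exact: wp.2 _ i0k.
- exact: p01 _ i0k.
- move=> Ai0; have : outside Z w (search (outside Z w) (w 0%N)).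
    apply: (searchP (i := i)); rewrite ?wp.1// outsideE//.
    by apply/negP => /set_mem.
  by rewrite outsideE// mem_set.
Qed.

Theorem theorem4 (R : realType) :
  N_reduces (NIN R) (HBU R) /\ N_reduces (Cantor_thm R) (HBU_Baire2 R).
Proof.
split; [exact: NIN_reduces_to_HBU|exact: Cantor_thm_reduces_to_HBU_Baire2].
Qed.
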